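(* Let $\mathbb{K}$ be a commutative ring with identity and let $N$ be a Nijenhuis operator on a Lie $\mathbb{K}$-affgebra $(A,[-,-])$. Then, for all $k,l\in\mathbb{N}$, the Lie brackets $[-,-]_{N^k}$ and $[-,-]_{N^l}$ are compatible in the sense that for all $\alpha\in\mathbb{K}$ the map $$A\times A\to A,\qquad (a,b)\mapsto \alpha\triangleright_{[a,b]_{N^k}}[a,b]_{N^l},$$ is a Lie bracket on $A$. Here $N^k$ is the $k$-th composition power of $N$ (with $N^0=\mathrm{id}$) and $[a,b]_{N^k}=\langle [N^k a,b],N^k[a,b],[a,N^k b]\rangle$.
   Context: Here $\mathbb{N}$ includes $0$. An abelian heap is a set $A$ with a ternary operation $\langle -,-,-\rangle:A^3\to A$ such that for all $a,b,c,d,e\in A$: $\langle\langle a,b,c\rangle,d,e\rangle=\langle a,b,\langle c,d,e\rangle\rangle$, $\langle a,b,b\rangle=a=\langle b,b,a\rangle$, $\langle a,b,c\rangle=\langle c,b,a\rangle$. Heap homomorphisms are maps preserving the ternary operation. One writes $\langle a_1,\ldots,a_{2n+1}\rangle:=\langle\ldots\langle\langle a_1,a_2,a_3\rangle,a_4,a_5\rangle,\ldots,a_{2n+1}\rangle$. An affine $\mathbb{K}$-module ($\mathbb{K}$ a commutative ring with identity) is a non-empty abelian heap $A$ with a map $\mathbb{K}\times A\times A\to A$, $(\alpha,a,b)\mapsto\alpha\triangleright_a b$, such that for all $a,b,c\in A$, $\alpha,\beta\in\mathbb{K}$: (a) $\alpha\triangleright_a-:A\to A$ and $-\triangleright_a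 b:\mathbb{K}\to A$ are heap homomorphisms, where $\mathbb{K}$ is a heap via $\alpha-\beta+\gamma$; (b) $(\alpha\beta)\triangleright_a b=\alpha\triangleright_a(\beta\triangleright_a b)$; (c) $\alpha\triangleright_a b=\langle\alpha\triangleright_c b,\alpha\triangleright_c a,a\rangle$; (d) $0\triangleright_a b=a$ and $1\triangleright_a b=b$. A homomorphism of affine $\mathbb{K}$-modules (affine map) is a heap homomorphism $f$ with $f(\alpha\triangleright_a b)=\alpha\triangleright_{f(a)}f(b)$. A map $A\times A\to A$ is bi-affine if it is an affine map in each argument separately. A Lie bracket on an affine $\mathbb{K}$-module $A$ (by convention, a left Lie bracket) is a bi-affine map $[-,-]:A\times A\to A$ such that for all $a,b,c\in A$: $\langle [a,b],[a,a],[b,a]\rangle=[b,b]$ and $\langle [a,[b,c]],[a,a],[b,[c,a]],[b,b],[c,[a,b]]\rangle=[c,c]$. An affine $\mathbb{K}$-module with a Lie bracket is called a Lie $\mathbb{K}$-affgebra. A Nijenhuis operator on a Lie affgebra $(A,[-,-])$ is an affine map $N:A\to A$ such that for all $a,b\in A$: $[Na,Nb]=N\big(\langle [Na,b],N[a,b],[a,Nb]\rangle\big)$. *)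

(* Defs.v *)
From HB Require Import structures.
From mathcomp Require Import all_boot all_algebra.

Set Implicit Arguments.
Unset Strict Implicit.
Unset Printing Implicit Defensive.

Import GRing.Theory.
Local Open Scope ring_scope.

HB.mixin Record isAbelianHeap A := {
  heap : A -> A -> A -> A;
  heapA : forall a b c d e, heap (heap a b c) d e = heap a b (heap c d e);
  heapKr : forall a b, heap a b b = a;
  heapKl : forall a b, heap b b a = a;
  heapC : forall a b c, heap a b c = heap c b a
}.

(* The empty heap is allowed here; affine modules exclude it below. *)
#[short(type="abelianHeapType")]
HB.structure Definition AbelianHeap := {A of isAbelianHeap A}.

Notation "[ 'heap' a , b , c ]" := (heap a b c)
  (at level 0, a, b, c at level 99, format "[ 'heap'  a ,  b ,  c ]").
Notation "[ 'heap' a , b , c , d , e ]" := (heap (heap a b c) d e)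
  (at level 0, a, b, c, d, e at level 99,
   format "[ 'heap'  a ,  b ,  c ,  d ,  e ]").

Definition is_heap_hom (A B : abelianHeapType) (f : A -> B) : Prop :=
  forall a b c, f [heap a, b, c] = [heap f a, f b, f c].

(* Alias of an abelian group V, carrying its heap structure x - y + z. *)
Definition group_heap (V : zmodType) : Type := V.

Section GroupHeap.
Variable V : zmodType.
Implicit Types a b c d e : V.

Let op a b c : V := a - b + c.

Fact group_heapA a b c d e : op (op a b c) d e = op a b (op c d e).
Proof. by rewrite /op !addrA. Qed.

Fact group_heapKr a b : op a b b = a.
Proof. exact: subrK. Qed.

Fact group_heapKl a b : op b b a = a.
Proof. by rewrite /op subrr add0r. Qed.

Fact group_heapC a b c : op a b c = op c b a.
Proof. by rewrite /op addrC addrA addrAC. Qed.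

HB.instance Definition _ := isAbelianHeap.Build (group_heap V)
  group_heapA group_heapKr group_heapKl group_heapC.

End GroupHeap.

(* [act alpha a b] is the action of alpha on b based at a; in a module,
   it is a + alpha (b - a). The ring K may be the zero ring. *)
HB.mixin Record AbelianHeap_isAffineModule (K : comPzRingType) A
    of AbelianHeap A := {
  act : K -> A -> A -> A;
  affine_nonempty : inhabited A;
  act_heapr : forall alpha a, is_heap_hom (act alpha a);
  act_heapl : forall a b,
    is_heap_hom (fun alpha : group_heap K => act alpha a b);
  actM : forall alpha beta a b,
    act (alpha * beta) a b = act alpha a (act beta a b);
  act_base : forall alpha a b c,
    act alpha a b = [heap act alpha c b, act alpha c a, a];
  act0 : forall a b, act 0 a b = a;
  act1 : forall a b, act 1 a b = b
}.

#[short(type="affineModType")]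
HB.structure Definition AffineModule (K : comPzRingType) :=
  {A of AbelianHeap A & AbelianHeap_isAffineModule K A}.

Notation "alpha |>[ a ] b" := (act alpha a b)
  (at level 40, a at level 99, format "alpha  |>[ a ]  b").

Section Affgebra.
Variable K : comPzRingType.

Definition is_affine_map (A B : affineModType K) (f : A -> B) : Prop :=
  is_heap_hom f /\
  forall (alpha : K) a b, f (alpha |>[a] b) = alpha |>[f a] f b.

Variable A : affineModType K.
Implicit Types (br : A -> A -> A) (N : A -> A).

Definition is_biaffine br : Prop :=
  (forall a, is_affine_map (fun b => br a b)) /\
  (forall b, is_affine_map (fun a => br a b)).

Definition is_lie_bracket br : Prop :=
  [/\ is_biaffine br,
      forall a b, [heap br a b, br a a, br b a] = br b b
    & forall a b c,
        [heap br a (br b c), br a a, br b (br c a), br b b, br c (br a b)]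
        = br c c].

Definition deformed_bracket br N : A -> A -> A :=
  fun a b => [heap br (N a) b, N (br a b), br a (N b)].

Definition is_nijenhuis br N : Prop :=
  is_affine_map N /\
  forall a b,
    br (N a) (N b) = N [heap br (N a) b, N (br a b), br a (N b)].

Definition lie_compatible br br' : Prop :=
  forall alpha : K,
    is_lie_bracket (fun a b => alpha |>[br a b] br' a b).

End Affgebra.

(* Main.v *)
Require Import Defs.
From HB Require Import structures.
From mathcomp Require Import all_boot all_algebra.

(** Say that affine maps [P], [Q] intertwine the bracket when
    [[Pa,Qb] = P[a,Qb] - PQ[a,b] + Q[Pa,b]]; for [P = Q] this is the Nijenhuis
    identity.  A Nijenhuis operator [N] makes [N^i] and [N^j] intertwine for all
    [i], [j], and the condition is affine in [P] and in [Q] separately, so every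
    pointwise affine combination [M] of [N^k] and [N^l] is again Nijenhuis.
    Deforming by a Nijenhuis operator yields a Lie bracket, and the bracket
    deformed by [M] is the same combination of the brackets deformed by [N^k]
    and [N^l]. *)

Set Implicit Arguments.
Unset Strict Implicit.
Unset Printing Implicit Defensive.

(** * Heaps as commutative monoids at a chosen base point *)

Section HeapSum.
Variables (A : abelianHeapType) (o : A).

Definition hadd (a b : A) : A := [heap a, o, b].

Lemma haddA : associative hadd.
Proof. by move=> a b c; rewrite /hadd heapA. Qed.

Lemma haddC : commutative hadd.
Proof. by move=> a b; rewrite /hadd heapC. Qed.

Lemma hadd0 : left_id o hadd.
Proof. by move=> a; rewrite /hadd heapKl. Qed.

HB.instance Definition _ := Monoid.isComLaw.Build A o hadd haddA haddC hadd0.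

Lemma haddI : right_injective hadd.
Proof.
move=> a b c /(congr1 (fun x => [heap o, a, x])).
by rewrite /hadd -!heapA !heapKr !heapKl.
Qed.

Lemma hadd_heap a b c : hadd b [heap a, b, c] = hadd a c.
Proof. by rewrite /hadd -heapA (heapC b o a) heapA heapKl. Qed.

End HeapSum.

(** * Equality of heap terms by reflection *)

Inductive heap_expr :=
| HAtom of nat
| HOp of heap_expr & heap_expr & heap_expr.

(** With [HOp t u v] read as [t - u + v], these are the atoms of positive and of negative sign, with
    multiplicity. *)
Fixpoint hpos (t : heap_expr) : seq nat :=
  match t with
  | HAtom i => [:: i]
  | HOp t u v => hpos t ++ hneg u ++ hpos v
  end
with hneg (t : heap_expr) : seq nat :=
  match t with
  | HAtom _ => [::]
  | HOp t u v => hneg t ++ hpos u ++ hneg v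
  end.

Section HeapExprValue.
Variables (A : abelianHeapType) (o : A) (env : nat -> A).

Fixpoint hval (t : heap_expr) : A :=
  match t with
  | HAtom i => env i
  | HOp t u v => [heap hval t, hval u, hval v]
  end.

Let hsum (s : seq nat) : A := \big[hadd o/o]_(i <- s) env i.

Let hsum_cat s1 s2 : hsum (s1 ++ s2) = hadd o (hsum s1) (hsum s2).
Proof. exact: big_cat. Qed.

Lemma hval_posneg t : hadd o (hval t) (hsum (hneg t)) = hsum (hpos t).
Proof.
elim: t => [i|t IHt u IHu v IHv] /=.
  by rewrite /hsum big_nil big_seq1 haddC hadd0.
have CA : left_commutative (hadd o) := @Monoid.mulmCA _ (hadd o).
rewrite !hsum_cat -IHt -IHu -IHv -!haddA.
rewrite (CA (hsum (hneg t))) haddA (haddC o [heap _, _, _]) hadd_heap -haddA.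
by congr hadd; rewrite !(CA (hval v)).
Qed.

(** Moving the negative atoms across leaves two sums in a commutative monoid, where order is
    immaterial and [haddI] cancels. *)
Lemma hval_perm t u :
  perm_eq (hpos t ++ hneg u) (hpos u ++ hneg t) -> hval t = hval u.
Proof.
move=> tu; apply: (@haddI _ o (hadd o (hsum (hneg t)) (hsum (hneg u)))).
have: hsum (hpos t ++ hneg u) = hsum (hpos u ++ hneg t) by apply: perm_big.
rewrite !hsum_cat -!hval_posneg => E.
rewrite haddC haddA E [RHS]haddC haddA -!haddA.
by rewrite [hadd o (hsum (hneg u)) _]haddC.
Qed.

End HeapExprValue.

(* Atoms are compared up to unification: occurrences of the same operation may
   carry different, convertible, structure instances. *)
Ltac heap_index x l :=
  match l with
  | ?y :: _ => let _ := match goal with _ => unify x y end in constr:(0)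
  | _ :: ?l' => let n := heap_index x l' in constr:(n.+1)
  end.

Ltac heap_atoms t l :=
  lazymatch t with
  | [heap ?a, ?b, ?c] =>
      let l := heap_atoms a l in let l := heap_atoms b l in heap_atoms c l
  | _ =>
      match l with
      | _ => let n := heap_index t l in l
      | _ => constr:(t :: l)
      end
  end.

Ltac heap_reify t l :=
  lazymatch t with
  | [heap ?a, ?b, ?c] =>
      let a := heap_reify a l in
      let b := heap_reify b l in
      let c := heap_reify c l in constr:(HOp a b c)
  | _ => let n := heap_index t l in constr:(HAtom n)
  end.

Ltac heap_abel :=
  lazymatch goal with
  | |- ?t = ?u :> ?A =>
      let l := heap_atoms t (@nil A) in
      let l := heap_atoms u l in
      let t' := heap_reify t l in
      let u' := heap_reify u l in
      lazymatch l with
      (* Any atom can serve as base point; the first one is also the default of [nth]. *)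
      | ?o :: _ =>
        apply: (@hval_perm _ o (nth o l) t' u'); vm_compute; reflexivity
      end
  end.

(* Adds the equation [y = x] to the goal [a = b] as the term [- x + y]. *)
Lemma heap_cancel (A : abelianHeapType) (x y a b : A) :
  x = y -> [heap a, x, y] = b -> a = b.
Proof. by move=> ->; rewrite heapKr. Qed.

Lemma heap_medial (A : abelianHeapType) (a b c a' b' c' a'' b'' c'' : A) :
  [heap [heap a, b, c], [heap a', b', c'], [heap a'', b'', c'']] =
  [heap [heap a, a', a''], [heap b, b', b''], [heap c, c', c'']].
Proof. heap_abel. Qed.

(** * Affine maps and their closure properties *)

Section AffineMaps.
Variables (K : comPzRingType) (A : affineModType K).
Implicit Types (f g h P Q N : A -> A) (br : A -> A -> A).

Lemma act_diag (alpha : K) (a : A) : alpha |>[a] a = a.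
Proof. by rewrite (act_base alpha a a a) heapKl. Qed.

Lemma act_heap (alpha : K) (a b c a' b' c' : A) :
  alpha |>[ [heap a, b, c] ] [heap a', b', c'] =
  [heap alpha |>[a] a', alpha |>[b] b', alpha |>[c] c'].
Proof.
rewrite (act_base _ [heap a, b, c] _ a) (act_base _ b _ a) (act_base _ c _ a).
rewrite !act_heapr act_diag; heap_abel.
Qed.

(** Once every action is rebased at [a], this reduces to commutativity of [K]. *)
Lemma act_act (alpha beta : K) (a b a' b' : A) :
  alpha |>[beta |>[a] b] (beta |>[a'] b') =
  beta |>[alpha |>[a] a'] (alpha |>[b] b').
Proof.
rewrite (act_base alpha (beta |>[a] b) _ a) (act_base beta a' _ a).
rewrite (act_base beta (alpha |>[a] a') _ a) (act_base alpha b _ a).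
rewrite !act_heapr -!actM (GRing.mulrC beta alpha); heap_abel.
Qed.

Lemma affine_comp f g :
  is_affine_map f -> is_affine_map g -> is_affine_map (fun a => f (g a)).
Proof.
by move=> [fH fA] [gH gA]; split=> [a b c|alpha a b]; rewrite ?gH ?fH ?gA ?fA.
Qed.

Lemma affine_iter n N : is_affine_map N -> is_affine_map (iter n N).
Proof. by move=> NA; elim: n => [|n IH] //; apply: affine_comp. Qed.

Lemma affine_heap f g h :
  is_affine_map f -> is_affine_map g -> is_affine_map h ->
  is_affine_map (fun a => [heap f a, g a, h a]).
Proof.
move=> [fH fA] [gH gA] [hH hA]; split=> [a b c|alpha a b].
  by rewrite fH gH hH heap_medial.
by rewrite fA gA hA act_heap.
Qed.

Lemma affine_act (alpha : K) f g :
  is_affine_map f -> is_affine_map g ->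
  is_affine_map (fun a => alpha |>[f a] g a).
Proof.
move=> [fH fA] [gH gA]; split=> [a b c|beta a b].
  by rewrite fH gH act_heap.
by rewrite fA gA act_act.
Qed.

Lemma deformed_biaffine br N :
  is_biaffine br -> is_affine_map N -> is_biaffine (deformed_bracket br N).
Proof.
move=> [brr brl] NA; split=> a; apply: affine_heap.
- exact: brr.
- exact: affine_comp.
- exact: (@affine_comp (br a) N).
- exact: (@affine_comp (br^~ a) N).
- exact: (@affine_comp N (br^~ a)).
- exact: brl.
Qed.

(** * Intertwining maps and Nijenhuis operators *)

Definition intertwine br P Q : Prop :=
  forall a b, br (P a) (Q b) = [heap P (br a (Q b)), P (Q (br a b)), Q (br (P a) b)].

Lemma intertwine_idl br Q : intertwine br (fun a => a) Q.
Proof. by move=> a b; rewrite heapKr. Qed.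

Lemma intertwine_idr br P : intertwine br P (fun a => a).
Proof. by move=> a b; rewrite heapKl. Qed.

(** The terms [P (Q (br (P' a) b))] of the two expansions cancel. *)
Lemma intertwine_compl br P P' Q : is_affine_map P ->
  intertwine br P Q -> intertwine br P' Q ->
  intertwine br (fun a => P (P' a)) Q.
Proof.
move=> [PH _] PQ P'Q a b; rewrite PQ P'Q PH; heap_abel.
Qed.

(** Applying [Q] to the expansion for [Q'] produces [Q (P _)], whereas [intertwine] has [P (Q _)] in
    its middle term; commutation reconciles them. *)
Lemma intertwine_compr br P Q Q' : is_affine_map Q ->
  (forall a, P (Q a) = Q (P a)) ->
  intertwine br P Q -> intertwine br P Q' ->
  intertwine br P (fun a => Q (Q' a)).
Proof.
by move=> [QH _] C PQ PQ' a b; rewrite PQ PQ' QH !C; heap_abel.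
Qed.

Lemma intertwine_iter br N i j : is_affine_map N ->
  intertwine br N N -> intertwine br (iter i N) (iter j N).
Proof.
move=> NA NN.
have NNj : intertwine br N (iter j N).
  elim: j => [|j IH]; first exact: intertwine_idr.
  exact: (@intertwine_compr br N N (iter j N)).
elim: i => [|i IH]; first exact: intertwine_idl.
exact: (@intertwine_compl br N (iter i N)).
Qed.

Lemma intertwine_actl (alpha : K) br P P' Q :
  is_biaffine br -> is_affine_map Q ->
  intertwine br P Q -> intertwine br P' Q ->
  intertwine br (fun a => alpha |>[P a] P' a) Q.
Proof.
move=> [_ brl] [_ QA] PQ P'Q a b.
by rewrite !(proj2 (brl _)) QA PQ P'Q act_heap.
Qed.

Lemma intertwine_actr (alpha : K) br P Q Q' :
  is_biaffine br -> is_affine_map P ->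
  intertwine br P Q -> intertwine br P Q' ->
  intertwine br P (fun a => alpha |>[Q a] Q' a).
Proof.
move=> [brr _] [_ PA] PQ PQ' a b.
by rewrite !(proj2 (brr _)) !PA PQ PQ' act_heap.
Qed.

Lemma nijenhuis_intertwine br N :
  is_nijenhuis br N <-> is_affine_map N /\ intertwine br N N.
Proof.
split=> -[NA NN]; split=> // a b; rewrite NN ?(proj1 NA) //; exact: heapC.
Qed.

Lemma nijenhuis_iter br N n : is_nijenhuis br N -> is_nijenhuis br (iter n N).
Proof.
move=> /nijenhuis_intertwine[NA NN]; apply/nijenhuis_intertwine.
by split; [apply: affine_iter | apply: intertwine_iter].
Qed.

Lemma nijenhuis_act_iter (alpha : K) br N k l :
  is_biaffine br -> is_nijenhuis br N ->
  is_nijenhuis br (fun a => alpha |>[iter k N a] iter l N a).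
Proof.
move=> brA /nijenhuis_intertwine[NA NN]; apply/nijenhuis_intertwine.
have NkA := affine_iter k NA; have NlA := affine_iter l NA.
have I i j := intertwine_iter i j NA NN.
split; first exact: affine_act.
by apply: intertwine_actl => //; first exact: affine_act;
  apply: intertwine_actr.
Qed.

(** * Deformed brackets *)

Lemma deformed_act (alpha : K) br P Q a b : is_biaffine br ->
  deformed_bracket br (fun c => alpha |>[P c] Q c) a b =
  alpha |>[deformed_bracket br P a b] deformed_bracket br Q a b.
Proof.
move=> [brr brl].
by rewrite /deformed_bracket (proj2 (brl _)) (proj2 (brr _)) act_heap.
Qed.

(** Stands in for functional extensionality, as [deformed_act] equates brackets only pointwise. *)
Lemma eq_lie_bracket br br' : (forall a b, br a b = br' a b) ->
  is_lie_bracket br -> is_lie_bracket br'.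
Proof.
move=> E [[brr brl] anti jac]; split.
- split=> a.
    by case: (brr a) => H M; split=> [x y z|alpha x y]; rewrite -!E ?H ?M.
  by case: (brl a) => H M; split=> [x y z|alpha x y]; rewrite -!E ?H ?M.
- by move=> a b; rewrite -!E.
- by move=> a b c; rewrite -!E.
Qed.

Lemma deformed_lie br N : is_lie_bracket br -> is_nijenhuis br N ->
  is_lie_bracket (deformed_bracket br N).
Proof.
move=> [brA anti jac] /nijenhuis_intertwine[NA NN].
have NH := proj1 NA.
have brr x : is_heap_hom (br x) := proj1 (proj1 brA x).
(* Antisymmetry at [(N x, x)] trades the mixed brackets for the diagonal terms that the identities
   of [br] produce. *)
have diag x : [heap br (N x) (N x), N (br x x), br x x] = deformed_bracket br N x x.
  rewrite /deformed_bracket; apply: (heap_cancel (esym (anti (N x) x))); heap_abel.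
split; first exact: deformed_biaffine.
  move=> a b; rewrite -!diag /deformed_bracket.
  apply: (heap_cancel (anti (N a) b)); apply: (heap_cancel (anti a (N b))).
  apply: (heap_cancel (esym (congr1 N (anti a b)))); rewrite !NH; heap_abel.
(* Accounts for the difference between [diag] and the diagonal terms collected from the Jacobi
   instances below. *)
have NNdiag x : [heap br (N x) (N x), N (br (N x) (N x)), N (N (br x x))] = N (br x x).
  rewrite [X in [heap X, _, _]]NN; apply: (heap_cancel (congr1 N (anti (N x) x))).
  rewrite !NH; heap_abel.
have ND a b : N (deformed_bracket br N a b) = br (N a) (N b).
  by rewrite /deformed_bracket !NH NN heapC.
(* In this expansion [N] occurs exactly twice in every term, so the cyclic sum
   splits into instances of the Jacobi identity for [br]. *)
have double a b c : deformed_bracket br N a (deformed_bracket br N b c) =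
    [heap [heap [heap br (N a) (br (N b) c), N (br (N a) (br b c)), br (N a) (br b (N c))],
       N (br a (br (N b) c)), br a (br (N b) (N c))],
       N (br a (br b (N c))), N (N (br a (br b c)))].
  rewrite /(deformed_bracket br N a) ND /deformed_bracket !brr !NH NN; heap_abel.
move=> a b c; rewrite !double -!diag.
(* Signs follow [double]: the instances with exactly one outer [N] count negatively, hence their
   [esym]. *)
apply: (heap_cancel (jac (N a) (N b) c)).
apply: (heap_cancel (jac (N a) b (N c))).
apply: (heap_cancel (jac a (N b) (N c))).
apply: (heap_cancel (esym (congr1 N (jac (N a) b c)))).
apply: (heap_cancel (esym (congr1 N (jac a (N b) c)))).
apply: (heap_cancel (esym (congr1 N (jac a b (N c))))).
apply: (heap_cancel (congr1 N (congr1 N (jac a b c)))).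
apply: (heap_cancel (NNdiag a)); apply: (heap_cancel (NNdiag b)).
apply: (heap_cancel (NNdiag c)).
rewrite !NH; heap_abel.
Qed.

End AffineMaps.

Theorem corollary4p7 (K : comPzRingType) (A : affineModType K)
    (br : A -> A -> A) (N : A -> A)
    (Hbr : is_lie_bracket br) (HN : is_nijenhuis br N) (k l : nat) :
  [/\ is_lie_bracket (deformed_bracket br (iter k N)),
      is_lie_bracket (deformed_bracket br (iter l N))
    & lie_compatible (deformed_bracket br (iter k N))
                     (deformed_bracket br (iter l N))].
Proof.
have brA : is_biaffine br by case: Hbr.
split; [exact/deformed_lie/nijenhuis_iter.. | move=> alpha].
apply: (eq_lie_bracket (fun a b => deformed_act alpha _ _ a b brA)).
exact/deformed_lie/nijenhuis_act_iter.
Qed.
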